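(* Let $n\ge p\ge1$ be such that $\dim St(n,p)\ge2$. The sectional curvature $K^{St}_e$ of the Stiefel manifold $St(n,p)$ under the Euclidean metric is globally bounded by $$-\tfrac12\le K^{St}_e(X,Y)\le 1$$ for all orthonormal pairs $X,Y$ of tangent vectors. Moreover: 1. For $p\ge2$, $n\ge p+2$, the bounds are sharp. Up to trace-preserving transformations, the maximum curvature is attained for the tangent plane spanned by $X=\begin{pmatrix}\mathbf0\\ B_1\end{pmatrix}$, $Y=\begin{pmatrix}\mathbf0\\ B_2\end{pmatrix}$ with $$B_1=\begin{pmatrix}0&0\\ 1&0\end{pmatrix},\quad B_2=\begin{pmatrix}1&0\\ 0&0\end{pmatrix},$$ and the minimum curvature is attained for the tangent plane spanned by such $X,Y$ with $$B_1=\begin{pmatrix}0&1\\ 0&0\end{pmatrix},\quad B_2=\begin{pmatrix}1&0\\ 0&0\end{pmatrix}$$ (in each case the $2\times2$ matrices are extended by zeros to size $(n-p)\times p$). 2. For $p=1$ and $n\ge3$, the sectional curvature has the constant value $K^{St}_e(X,Y)\equiv1$. 3. For $p=n\ge4$, $0\le K^{St}_e(X,Y)\le\frac14$. 4. For $p=n=3$, $K^{St}_e(X,Y)\equiv\frac18$. 5. For $(n,p)=(3,2)$, $-\frac12\le K^{St}_e(X,Y)\le\frac12$, and the bounds are sharp. The lower bound is attained for zero $A$-blocks and $B_1=(0\ \ 1)$, $B_2=(1\ \ 0)$. The upper bound is attained, e.g., for $$X=\begin{pmatrix}0&0\\ 0&0\\ -1&0\end{pmatrix},\qquad Y=\begin{pmatrix}0&-\frac1{\sqrt2}\\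 \frac1{\sqrt2}&0\\ 0&0\end{pmatrix}.$$ 6. For $n\ge4$ and $p=n-1$, $-\frac12\le K^{St}_e(X,Y)\le\frac23$. The lower bound is sharp and is attained for zero $A$-blocks and $B_1=(0,1,0,\dots,0)$, $B_2=(1,0,\dots,0)\in\mathbb{R}^{1\times(n-1)}$.
   Context: $St(n,p)=\{U\in\mathbb{R}^{n\times p}\mid U^TU=I_p\}$, considered as an embedded submanifold of $\mathbb{R}^{n\times p}$. The Euclidean metric is the restriction of $\langle\Delta,\tilde\Delta\rangle=\operatorname{tr}(\Delta^T\tilde\Delta)$ to the tangent spaces. Shifting the base point has no impact on the curvature, so tangent planes are considered at $\begin{pmatrix}I_p\\ \mathbf0\end{pmatrix}$, where tangent vectors are $\begin{pmatrix}A\\ B\end{pmatrix}$ with $A\in\mathbb{R}^{p\times p}$, $A^T=-A$, and $B\in\mathbb{R}^{(n-p)\times p}$. For $p=n$ the $B$-blocks are empty. Tangent vectors $X=\begin{pmatrix}A_1\\ B_1\end{pmatrix}$, $Y=\begin{pmatrix}A_2\\ B_2\end{pmatrix}$ are orthonormal iff $\|A_i\|_F^2+\|B_i\|_F^2=1$ for $i=1,2$ and $\operatorname{tr}(A_1^TA_2)+\operatorname{tr}(B_1^TB_2)=0$. For such an orthonormal pair, the sectional curvature of the plane spanned by $X,Y$ is $$K^{St}_e(X,Y)=\|B_1A_2-B_2A_1\|_F^2+\tfrac12\|B_1B_2^T-B_2B_1^T\|_F^2-\tfrac12\|B_1^TB_2-B_2^TB_1\|_F^2+\tfrac14\|[A_1,A_2]-(B_2^TB_1-B_1^TB_2)\|_F^2,$$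 where $[A_1,A_2]=A_1A_2-A_2A_1$ and $\|\cdot\|_F$ is the Frobenius norm. All curvature statements refer to orthonormal pairs $X,Y$. A trace-preserving transformation is a simultaneous change of coordinates $(B_1,B_2)\mapsto(U^TB_1V,\,U^TB_2V)$ with orthogonal matrices $U\in O(n-p)$, $V\in O(p)$. A bound is called sharp if it is attained by some tangent plane. *)

(* Defs.v *)
From mathcomp Require Import all_boot all_order all_algebra.
From mathcomp Require Export reals.

Set Implicit Arguments.
Unset Strict Implicit.
Unset Printing Implicit Defensive.

Import Order.TTheory GRing.Theory Num.Theory.
Local Open Scope ring_scope.

Definition stiefel_dim (n p : nat) : nat := (n * p - (p * p.+1) %/ 2)%N.

Definition frob2 (R : realType) (m k : nat) (M : 'M[R]_(m, k)) : R :=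
  \tr (M^T *m M).

(* With q = n - p, a tangent vector of St(n,p) at the base point
   col_mx 1%:M 0 is a matrix X of size (p + q) x p with blocks
   A = usubmx X and B = dsubmx X, where A is skew-symmetric. *)
Definition tangent (R : realType) (p q : nat) (X : 'M[R]_(p + q, p)) : Prop :=
  (usubmx X)^T = - usubmx X.

Definition metric (R : realType) (p q : nat) (X Y : 'M[R]_(p + q, p)) : R :=
  \tr (X^T *m Y).

Definition orthonormal_tangent (R : realType) (p q : nat)
    (X Y : 'M[R]_(p + q, p)) : Prop :=
  [/\ tangent X, tangent Y, metric X X = 1, metric Y Y = 1 & metric X Y = 0].

(* Closed form of the sectional curvature of the plane spanned by an
   orthonormal pair, for the Euclidean (embedded) metric. *)
Definition sec_curv (R : realType) (p q : nat) (X Y : 'M[R]_(p + q, p)) : R :=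
  let A1 := usubmx X in let B1 := dsubmx X in
  let A2 := usubmx Y in let B2 := dsubmx Y in
  frob2 (B1 *m A2 - B2 *m A1)
  + 2^-1 * frob2 (B1 *m B2^T - B2 *m B1^T)
  - 2^-1 * frob2 (B1^T *m B2 - B2^T *m B1)
  + 4^-1 * frob2 ((A1 *m A2 - A2 *m A1) - (B2^T *m B1 - B1^T *m B2)).

Definition curv_attained (R : realType) (p q : nat) (c : R) : Prop :=
  exists X Y : 'M[R]_(p + q, p), orthonormal_tangent X Y /\ sec_curv X Y = c.

Definition orthogonal_mx (R : realType) (m : nat) (U : 'M[R]_m) : Prop :=
  U^T *m U = 1%:M.

Definition trace_preserving_equiv (R : realType) (m k : nat)
    (B1 B2 C1 C2 : 'M[R]_(m, k)) : Prop :=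
  exists (U : 'M[R]_m) (V : 'M[R]_k),
    [/\ orthogonal_mx U, orthogonal_mx V,
        U^T *m B1 *m V = C1 & U^T *m B2 *m V = C2].

(* Matrix unit with its 1 in row a, column b (counted from 0).  The position is
   given by natural numbers, so that the size of the matrix may be symbolic;
   outside the range of indices the result is 0. *)
Definition elem_mx (R : realType) (m k a b : nat) : 'M[R]_(m, k) :=
  \matrix_(i < m, j < k) ((i == a :> nat) && (j == b :> nat))%:R.
Arguments elem_mx {R m k} a b.

(* Tangent vector with A-block 0. *)
Definition tangentB (R : realType) (p q : nat) (B : 'M[R]_(q, p)) :
  'M[R]_(p + q, p) := col_mx 0 B.
Arguments tangentB {R p q} B.

(* Main.v *)
(* For tangent X and Y the Gauss equation gives
     K(X, Y) = |X Y^T|^2 - |X^T Y + Y^T X|^2 / 4,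
   which with W = X Y^T also reads
     K(X, Y) = |W|^2 / 2 + |W - W^T|^2 / 4 - |X^T Y|^2 / 2.
   As the Frobenius norm is submultiplicative, -1/2 <= K <= 1.  Equality forces
   the 2 x 2 minors in Lagrange's identity for |X|^2 |Y|^2 - |X^T Y|^2 (resp.
   for the transposes) to vanish, so that X and Y have rank one with a common
   column (resp. row) space; a skew-symmetric matrix of rank at most one is 0,
   so the A-blocks vanish, and Householder reflections bring the B-blocks to
   normal form.

   For p = n the bound is |[A1, A2]|^2 <= |A1|^2 |A2|^2 for skew-symmetric
   matrices: for orthogonal A1, A2 it follows from |[A1, A2]| <= 2 |A1 A2| and
   from 4 |A1 A2|^2 <= |A1|^2 |A2|^2 + <A1, A2>^2, which says that the norm of
   the 4-form A1 /\ A2 is nonnegative.  For p = n - 1 it is combined with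
   |b A|^2 <= |b|^2 |A|^2 / 2 for row vectors b and skew-symmetric A. *)

Require Import Defs.
From mathcomp Require Import all_boot all_order all_algebra.
From mathcomp Require Import reals ring lra.

Set Implicit Arguments.
Unset Strict Implicit.
Unset Printing Implicit Defensive.

Import Order.TTheory GRing.Theory Num.Theory.
Local Open Scope ring_scope.

(** * The Frobenius inner product and norm *)

(** Polarizes [frob2] for matrices of every size: [frob2 M] is convertible to [fdot M M], and
    [metric X Y] to [fdot X Y]. *)
Definition fdot (R : realType) (m k : nat) (M N : 'M[R]_(m, k)) : R :=
  \tr (M^T *m N).

Lemma fdotE (R : realType) (m k : nat) (M N : 'M[R]_(m, k)) :
  fdot M N = \sum_i \sum_j M i j * N i j.
Proof.
rewrite /fdot /mxtrace exchange_big /=; apply: eq_bigr => j _.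
by rewrite !mxE; apply: eq_bigr => i _; rewrite !mxE.
Qed.

Lemma fdotC (R : realType) (m k : nat) (M N : 'M[R]_(m, k)) :
  fdot M N = fdot N M.
Proof. by rewrite /fdot -mxtrace_tr trmx_mul trmxK. Qed.

Lemma fdotDl (R : realType) (m k : nat) (M N L : 'M[R]_(m, k)) :
  fdot (M + N) L = fdot M L + fdot N L.
Proof. by rewrite /fdot linearD /= mulmxDl linearD. Qed.

Lemma fdotZl (R : realType) (m k : nat) c (M L : 'M[R]_(m, k)) :
  fdot (c *: M) L = c * fdot M L.
Proof. by rewrite /fdot linearZ /= -scalemxAl linearZ. Qed.

Lemma fdotNl (R : realType) (m k : nat) (M L : 'M[R]_(m, k)) :
  fdot (- M) L = - fdot M L.
Proof. by rewrite -scaleN1r fdotZl mulN1r. Qed.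

Lemma fdotDr (R : realType) (m k : nat) (M N L : 'M[R]_(m, k)) :
  fdot L (M + N) = fdot L M + fdot L N.
Proof. by rewrite fdotC fdotDl !(fdotC L). Qed.

Lemma fdotZr (R : realType) (m k : nat) c (M L : 'M[R]_(m, k)) :
  fdot L (c *: M) = c * fdot L M.
Proof. by rewrite fdotC fdotZl fdotC. Qed.

Lemma fdotNr (R : realType) (m k : nat) (M L : 'M[R]_(m, k)) :
  fdot L (- M) = - fdot L M.
Proof. by rewrite fdotC fdotNl fdotC. Qed.

Definition fdot_linE := (fdotDl, fdotDr, fdotNl, fdotNr, fdotZl, fdotZr).

Lemma fdot_tr (R : realType) (m k : nat) (M N : 'M[R]_(m, k)) :
  fdot M^T N^T = fdot M N.
Proof. by rewrite /fdot trmxK mxtrace_mulC -mxtrace_tr trmx_mul trmxK. Qed.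

Lemma frob2E (R : realType) (m k : nat) (M : 'M[R]_(m, k)) :
  frob2 M = fdot M M.
Proof. by []. Qed.

Lemma frob2_tr (R : realType) (m k : nat) (M : 'M[R]_(m, k)) :
  frob2 M^T = frob2 M.
Proof. exact: fdot_tr. Qed.

Lemma frob20 (R : realType) (m k : nat) : frob2 (0 : 'M[R]_(m, k)) = 0.
Proof. by rewrite /frob2 mulmx0 linear0. Qed.

Lemma frob2_ge0 (R : realType) (m k : nat) (M : 'M[R]_(m, k)) : 0 <= frob2 M.
Proof.
rewrite frob2E fdotE; apply: sumr_ge0 => i _; apply: sumr_ge0 => j _.
by rewrite -expr2 sqr_ge0.
Qed.

Lemma frob2_eq0 (R : realType) (m k : nat) (M : 'M[R]_(m, k)) :
  frob2 M = 0 -> M = 0.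
Proof.
move/eqP; rewrite frob2E fdotE psumr_eq0 => [/allP M0|i _]; last first.
  by apply: sumr_ge0 => j _; rewrite -expr2 sqr_ge0.
apply/matrixP => i j; rewrite mxE; have /= := M0 i (mem_index_enum i).
rewrite psumr_eq0 => [/allP/(_ j (mem_index_enum j))/=|l _].
  by rewrite mulf_eq0 orbb => /eqP.
by rewrite -expr2 sqr_ge0.
Qed.

(** The squared norm of |N|^2 M - <M, N> N equals |N|^2 (|M|^2 |N|^2 - <M, N>^2). *)
Lemma fdot_CS (R : realType) (m k : nat) (M N : 'M[R]_(m, k)) :
  fdot M N ^+ 2 <= frob2 M * frob2 N.
Proof.
have [N0|N0] := eqVneq (frob2 N) 0.
  by rewrite (frob2_eq0 N0) /fdot mulmx0 linear0 frob20 mulr0 expr0n.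
have Npos : 0 < frob2 N by rewrite lt0r N0 frob2_ge0.
have := frob2_ge0 (frob2 N *: M - fdot M N *: N).
rewrite frob2E !fdot_linE -!frob2E (fdotC N M) => H.
rewrite -subr_ge0 -(pmulr_rge0 _ Npos); move: H; congr (0 <= _); ring.
Qed.

(** Triangle inequality; bounds [s] and [t] on the norms keep square roots out of the statement. *)
Lemma frob2B_le (R : realType) (m k : nat) (M N : 'M[R]_(m, k)) (s t : R) :
  0 <= s -> 0 <= t -> frob2 M <= s ^+ 2 -> frob2 N <= t ^+ 2 ->
  frob2 (M - N) <= (s + t) ^+ 2.
Proof.
move=> s0 t0 Ms Nt; rewrite frob2E !fdot_linE (fdotC N M) -!frob2E.
have : - fdot M N <= s * t.
  rewrite (le_trans (ler_norm _)) // normrN -ler_sqr ?nnegrE ?mulr_ge0 //.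
  by rewrite real_normK ?num_real // exprMn (le_trans (fdot_CS _ _)) //
             ler_pM // frob2_ge0.
rewrite sqrrD; lra.
Qed.

(** * Lagrange's identity and its rank-one equality case *)

(** Expanding the squared minors gives |X|^2 |Y|^2 twice, and cross terms that sum to |X^T Y|^2. *)
Lemma frob2_mul_lagrange (R : realType) (m k l : nat)
    (X : 'M[R]_(m, k)) (Y : 'M[R]_(m, l)) :
  \sum_i \sum_i' \sum_j \sum_j' (X i j * Y i' j' - X i' j * Y i j') ^+ 2 =
  2 * (frob2 X * frob2 Y - frob2 (X^T *m Y)).
Proof.
have E1 : \sum_i \sum_i' \sum_j \sum_j' (X i j * Y i' j') ^+ 2
          = frob2 X * frob2 Y.
  rewrite !frob2E !fdotE mulr_suml; apply: eq_bigr => i _.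
  rewrite mulr_sumr; apply: eq_bigr => i' _.
  rewrite mulr_suml; apply: eq_bigr => j _.
  rewrite mulr_sumr; apply: eq_bigr => j' _; ring.
have E2 : \sum_i \sum_i' \sum_j \sum_j' (X i' j * Y i j') ^+ 2
          = frob2 X * frob2 Y.
  by rewrite exchange_big.
have E3 : \sum_i \sum_i' \sum_j \sum_j' (X i j * Y i j') * (X i' j * Y i' j')
          = frob2 (X^T *m Y).
  rewrite frob2E fdotE.
  under eq_bigr do rewrite exchange_big.
  rewrite exchange_big; apply: eq_bigr => j _ /=.
  under eq_bigr do rewrite exchange_big.
  rewrite exchange_big; apply: eq_bigr => j' _ /=.
  rewrite !mxE mulr_suml; apply: eq_bigr => i _.
  rewrite mulr_sumr; apply: eq_bigr => i' _; rewrite !mxE; ring.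
rewrite mulrBr mulr_natl mulr2n -{1}E1 -E2 -E3 mulr_sumr -big_split -sumrB.
apply: eq_bigr => i _; rewrite /= mulr_sumr -big_split -sumrB.
apply: eq_bigr => i' _; rewrite /= mulr_sumr -big_split -sumrB.
apply: eq_bigr => j _; rewrite /= mulr_sumr -big_split -sumrB.
apply: eq_bigr => j' _ /=; ring.
Qed.

Lemma frob2_mul_le (R : realType) (m k l : nat)
    (X : 'M[R]_(m, k)) (Y : 'M[R]_(m, l)) :
  frob2 (X^T *m Y) <= frob2 X * frob2 Y.
Proof.
rewrite -subr_ge0 -(pmulr_rge0 _ (ltr0n R 2)) -frob2_mul_lagrange.
by do 4!(apply: sumr_ge0 => ? _); exact: sqr_ge0.
Qed.

Lemma frob2_mul_eq (R : realType) (m k l : nat)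
    (X : 'M[R]_(m, k)) (Y : 'M[R]_(m, l)) :
  frob2 (X^T *m Y) = frob2 X * frob2 Y ->
  forall i i' j j', X i j * Y i' j' = X i' j * Y i j'.
Proof.
move=> eqXY i i' j j'; apply/eqP; rewrite -subr_eq0 -sqrf_eq0.
have /eqP := frob2_mul_lagrange X Y; rewrite eqXY subrr mulr0.
rewrite psumr_eq0 => [/allP/(_ i (mem_index_enum _))/=|? _]; last first.
  by do 3!(apply: sumr_ge0 => ? _); exact: sqr_ge0.
rewrite psumr_eq0 => [/allP/(_ i' (mem_index_enum _))/=|? _]; last first.
  by do 2!(apply: sumr_ge0 => ? _); exact: sqr_ge0.
rewrite psumr_eq0 => [/allP/(_ j (mem_index_enum _))/=|? _]; last first.
  by do 1!(apply: sumr_ge0 => ? _); exact: sqr_ge0.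
by rewrite psumr_eq0 => [/allP/(_ j' (mem_index_enum _))/=|? _] //; rewrite sqr_ge0.
Qed.

Lemma frob2_outer (R : realType) (m k : nat) (u : 'cV[R]_m) (x : 'rV[R]_k) :
  frob2 (u *m x) = frob2 u * frob2 x.
Proof.
rewrite /frob2 trmx_mul mulmxA -(mulmxA x^T) [u^T *m u]mx11_scalar.
by rewrite mul_mx_scalar -scalemxAl linearZ /= mxtrace_scalar.
Qed.

Lemma matrix_neq0 (R : realType) (m k : nat) (M : 'M[R]_(m, k)) :
  frob2 M = 1 -> exists i j, M i j != 0.
Proof.
move=> M1; case: (pickP (fun t : 'I_m * 'I_k => M t.1 t.2 != 0)) => [[i j] h|M0].
  by exists i, j.
have M00 : M = 0.
  by apply/matrixP => i j; rewrite mxE; apply/eqP/negbFE/(M0 (i, j)).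
by move/eqP: M1; rewrite M00 frob20 eq_sym oner_eq0.
Qed.

(** Vanishing minors make all columns of X and Y multiples of one nonzero column [v] of Y; [u] is
    [v] normalized. *)
Lemma frob2_mul_eq1 (R : realType) (m k l : nat)
    (X : 'M[R]_(m, k)) (Y : 'M[R]_(m, l)) :
  frob2 X = 1 -> frob2 Y = 1 -> frob2 (X^T *m Y) = 1 ->
  exists (u : 'cV[R]_m) (x : 'rV[R]_k) (y : 'rV[R]_l),
    [/\ X = u *m x, Y = u *m y, frob2 u = 1, frob2 x = 1 & frob2 y = 1].
Proof.
move=> X1 Y1 XY1.
have /frob2_mul_eq minors : frob2 (X^T *m Y) = frob2 X * frob2 Y.
  by rewrite X1 Y1 mulr1.
have [i0 [j0 nz]] := matrix_neq0 Y1; have [i1 [j1 nz1]] := matrix_neq0 X1.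
pose v := col j0 Y.
have v0 : frob2 v != 0.
  apply: contra nz => /eqP/frob2_eq0/matrixP/(_ i0 0); rewrite !mxE => ->.
  by rewrite eqxx.
have vpos : 0 < frob2 v by rewrite lt0r v0 frob2_ge0.
pose c := Num.sqrt (frob2 v).
have c0 : c != 0 by rewrite sqrtr_eq0 -ltNge.
have c2 : c ^+ 2 = frob2 v by rewrite sqr_sqrtr ?frob2_ge0.
pose u := c^-1 *: v.
have u1 : frob2 u = 1.
  by rewrite frob2E !fdot_linE -frob2E -c2; field.
(* Column j of X is X i0 j / Y i0 j0 times [v]; the factor [c] undoes the normalization. *)
pose x := \row_j (c * X i0 j / Y i0 j0).
have Xux : X = u *m x.
  apply/matrixP => i j; rewrite !mxE big_ord1 !mxE.
  apply: (mulIf nz); rewrite minors; field.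
  by rewrite c0 nz.
(* The minor through X i1 j1 expresses Y i j by column j1 of X, already known to be a multiple of
   [u]. *)
pose y := \row_j (x 0 j1 * Y i1 j / X i1 j1).
have Yuy : Y = u *m y.
  apply/matrixP => i j; rewrite mxE big_ord1 [y 0 j]mxE.
  have Xij1 : X i j1 = u i 0 * x 0 j1 by rewrite Xux mxE big_ord1.
  by apply: (mulfI nz1); rewrite minors Xij1; field.
exists u, x, y; split=> //.
  by rewrite -X1 Xux frob2_outer u1 mul1r.
by rewrite -Y1 Yuy frob2_outer u1 mul1r.
Qed.

(** Skew-symmetry gives (u_i x_j)^2 = - (u_i x_i) (u_j x_j), and the diagonal entries vanish. *)
Lemma skew_outer_eq0 (R : realType) (p : nat) (u : 'cV[R]_p) (x : 'rV[R]_p) :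
  (u *m x)^T = - (u *m x) -> u *m x = 0.
Proof.
move=> /matrixP sk.
have e i j : u j 0 * x 0 i = - (u i 0 * x 0 j).
  by have := sk i j; rewrite !mxE !big_ord1.
apply/matrixP => i j; rewrite !mxE big_ord1.
have d k : u k 0 * x 0 k = 0 by have := e k k; lra.
apply/eqP; rewrite -sqrf_eq0 expr2 {1}(_ : u i 0 * x 0 j = - (u j 0 * x 0 i)).
  rewrite mulNr oppr_eq0 mulrACA (mulrC (u j 0)) mulrACA d mul0r //.
by rewrite (e i j) opprK.
Qed.

(** * Householder reflections and normal forms of orthonormal pairs *)

Lemma fdot_row (R : realType) (p : nat) (x y : 'rV[R]_p) :
  x *m y^T = (fdot x y)%:M.
Proof.
by rewrite [LHS]mx11_scalar /fdot mxtrace_mulC -mxtrace_tr trmx_mul trmxK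
  mxtrace_mulC -(mxtrace_mulC x) /mxtrace big_ord1.
Qed.

(** Reflection in the hyperplane orthogonal to x - e, or the identity if x = e. The last clause lets
    a second reflection leave an already placed vector in place. *)
Lemma householder (R : realType) (p : nat) (x e : 'rV[R]_p) :
  frob2 x = 1 -> frob2 e = 1 ->
  exists V : 'M[R]_p, [/\ orthogonal_mx V, x *m V = e &
    forall z, fdot z x = fdot z e -> z *m V = z].
Proof.
move=> x1 e1; pose w := x - e.
have [/frob2_eq0/eqP|w0] := eqVneq (frob2 w) 0.
  rewrite subr_eq0 => /eqP ->; exists 1%:M.
  by split=> [||z _]; rewrite ?mulmx1 // /orthogonal_mx trmx1 mulmx1.
pose H := 1%:M - (2 / frob2 w) *: (w^T *m w).
have zH z : z *m H = z - (2 / frob2 w * fdot z w) *: w.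
  rewrite mulmxBr mulmx1 -scalemxAr mulmxA fdot_row mul_scalar_mx scalerA //.
exists H; split.
- rewrite /orthogonal_mx.
  have -> : H^T = H.
    by rewrite /H linearB /= trmx1 linearZ /= trmx_mul trmxK.
  rewrite {2}/H mulmxBr mulmx1 -scalemxAr mulmxA.
  (* [w] spans the eigenspace for -1, so the symmetric matrix [H] is an involution. *)
  suff -> : H *m w^T = - w^T.
    rewrite mulNmx scalerN opprK /H addrNK //.
  rewrite mulmxBl mul1mx -scalemxAl -mulmxA fdot_row mul_mx_scalar scalerA.
  by rewrite divfK // scaler_nat mulr2n opprD addrA subrr add0r.
- rewrite zH; have xw : fdot x w * 2 = frob2 w.
    rewrite frob2E /w !fdot_linE -!frob2E (fdotC e x) x1 e1; ring.
  rewrite mulrAC -(mulrC (fdot x w)) xw divff // scale1r /w opprB addrC subrK //.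
- by move=> z zx; rewrite zH /w !fdot_linE zx subrr mulr0 scale0r subr0.
Qed.

Lemma orthogonal_mx_mul (R : realType) (p : nat) (U V : 'M[R]_p) :
  orthogonal_mx U -> orthogonal_mx V -> orthogonal_mx (U *m V).
Proof.
rewrite /orthogonal_mx => hU hV.
by rewrite trmx_mul -mulmxA (mulmxA U^T) hU mul1mx.
Qed.

(** One reflection takes x to e, a second takes the image of y to f; that image and f are both
    orthogonal to e, so the second one fixes e. *)
Lemma orthogonal_pair (R : realType) (p : nat) (x y e f : 'rV[R]_p) :
  frob2 x = 1 -> frob2 y = 1 -> fdot x y = 0 ->
  frob2 e = 1 -> frob2 f = 1 -> fdot e f = 0 ->
  exists V : 'M[R]_p, [/\ orthogonal_mx V, x *m V = e & y *m V = f].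
Proof.
move=> x1 y1 xy e1 f1 ef; have [H [oH xH _]] := householder x1 e1.
have HHt : H *m H^T = 1%:M by exact: mulmx1C.
have dotH (a b : 'rV[R]_p) : fdot (a *m H) (b *m H) = fdot a b.
  rewrite !/(fdot _ _) -!(mxtrace_mulC _ (_^T)).
  by rewrite trmx_mul mulmxA -(mulmxA b) HHt mulmx1.
have yH1 : frob2 (y *m H) = 1 by rewrite frob2E dotH.
have [H' [oH' yH' fixH']] := householder yH1 f1.
exists (H *m H'); split; rewrite ?mulmxA; [exact: orthogonal_mx_mul| |exact: yH'].
by rewrite xH fixH' // -{1}xH dotH xy ef.
Qed.

(** * Norm inequalities for skew-symmetric matrices *)

Definition sum4 (R : realType) (p : nat) (f : 'I_p -> 'I_p -> 'I_p -> 'I_p -> R) : R :=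
  \sum_i \sum_j \sum_k \sum_l f i j k l.

Lemma eq_sum4 (R : realType) (p : nat) (f g : 'I_p -> 'I_p -> 'I_p -> 'I_p -> R) :
  (forall i j k l, f i j k l = g i j k l) -> sum4 f = sum4 g.
Proof. by move=> fg; do 4!(apply: eq_bigr => ? _); rewrite fg. Qed.

Lemma sum4D (R : realType) (p : nat) (f g : 'I_p -> 'I_p -> 'I_p -> 'I_p -> R) :
  sum4 (fun i j k l => f i j k l + g i j k l) = sum4 f + sum4 g.
Proof. by do 4!(rewrite /sum4 -?big_split /=; try (apply: eq_bigr => ? _)). Qed.

Lemma sum4Z (R : realType) (p : nat) c (f : 'I_p -> 'I_p -> 'I_p -> 'I_p -> R) :
  sum4 (fun i j k l => c * f i j k l) = c * sum4 f.
Proof. by do 4!(rewrite [RHS]mulr_sumr; apply: eq_bigr => ? _). Qed.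

Lemma sum4_swap12 (R : realType) (p : nat) (f : 'I_p -> 'I_p -> 'I_p -> 'I_p -> R) :
  sum4 (fun i j k l => f j i k l) = sum4 f.
Proof. exact: exchange_big. Qed.

Lemma sum4_swap23 (R : realType) (p : nat) (f : 'I_p -> 'I_p -> 'I_p -> 'I_p -> R) :
  sum4 (fun i j k l => f i k j l) = sum4 f.
Proof. by apply: eq_bigr => ? _; exact: exchange_big. Qed.

Lemma sum4_swap34 (R : realType) (p : nat) (f : 'I_p -> 'I_p -> 'I_p -> 'I_p -> R) :
  sum4 (fun i j k l => f i j l k) = sum4 f.
Proof. by do 2!(apply: eq_bigr => ? _); exact: exchange_big. Qed.

Lemma sum4_prod (R : realType) (p : nat) (f g : 'I_p -> 'I_p -> R) :
  sum4 (fun i j k l => f i j * g k l) =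
  (\sum_i \sum_j f i j) * (\sum_i \sum_j g i j).
Proof.
rewrite mulr_suml; apply: eq_bigr => i _.
rewrite mulr_suml; apply: eq_bigr => j _.
rewrite mulr_sumr; apply: eq_bigr => k _.
by rewrite mulr_sumr.
Qed.

Lemma frob2_mulE (R : realType) (p : nat) (A B : 'M[R]_p) :
  frob2 (A *m B) = sum4 (fun i j k l => A i j * B j l * (A i k * B k l)).
Proof.
rewrite frob2E fdotE; apply: eq_bigr => i _.
transitivity (\sum_l \sum_j \sum_k A i j * B j l * (A i k * B k l)).
  apply: eq_bigr => l _; rewrite !mxE mulr_suml; apply: eq_bigr => j _.
  by rewrite mulr_sumr.
rewrite exchange_big; apply: eq_bigr => j _; exact: exchange_big.
Qed.

(* The sum of the squared entries of the 4-form A /\ B, where A and B are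
   viewed as 2-forms, equals 6 (|A|^2 |B|^2 + <A, B>^2 - 4 |A B|^2). *)
Lemma skew_frob2_mul_le (R : realType) (p : nat) (A B : 'M[R]_p) :
  A^T = - A -> B^T = - B ->
  4 * frob2 (A *m B) <= frob2 A * frob2 B + fdot A B ^+ 2.
Proof.
move=> /matrixP skA /matrixP skB.
have sA i j : A i j = - A j i by have := skA j i; rewrite !mxE.
have sB i j : B i j = - B j i by have := skB j i; rewrite !mxE.
(* [P] collects the two terms of A /\ B that belong to the splitting {i, j}, {k, l} of the
   indices. *)
pose P i j k l := A i j * B k l + A k l * B i j.
pose F i j k l := A i j * B j l * (A i k * B k l).
have PP : sum4 (fun i j k l => P i j k l * P i j k l)
          = 2 * (frob2 A * frob2 B + fdot A B ^+ 2).
  rewrite (@eq_sum4 _ _ _ (fun i j k l =>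
      ((A i j * A i j) * (B k l * B k l) + (B i j * B i j) * (A k l * A k l))
      + 2 * ((A i j * B i j) * (A k l * B k l)))); last first.
    by move=> i j k l; rewrite /P; ring.
  rewrite sum4D sum4D sum4Z !sum4_prod -!fdotE -!frob2E; ring.
(* By skew-symmetry each of the four products is a relabelling of the closed 4-cycle [F], whose sum
   is |A B|^2. *)
have PQ : sum4 (fun i j k l => P i j k l * P i k j l) = 4 * frob2 (A *m B).
  rewrite frob2_mulE -/F (@eq_sum4 _ _ _ (fun i j k l =>
      (F i j k l + F j i l k) + (F k i l j + F l j k i))); last first.
    move=> i j k l; rewrite /P /F (sA j i) (sA k i) (sA l j) (sA l k).
    rewrite (sB j i) (sB k i) (sB l j) (sB l k); ring.
  rewrite !sum4D.
  have -> : sum4 (fun i j k l => F j i l k) = sum4 F.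
    by rewrite (sum4_swap12 (fun i j k l => F i j l k)) sum4_swap34.
  have -> : sum4 (fun i j k l => F k i l j) = sum4 F.
    rewrite -(sum4_swap23 (fun i j k l => F k i l j)).
    by rewrite (sum4_swap12 (fun i j k l => F i j l k)) sum4_swap34.
  have -> : sum4 (fun i j k l => F l j k i) = sum4 F.
    rewrite -(sum4_swap12 (fun i j k l => F l j k i)).
    rewrite -(sum4_swap34 (fun i j k l => F l i k j)).
    rewrite -(sum4_swap23 (fun i j k l => F k i l j)).
    by rewrite (sum4_swap12 (fun i j k l => F i j l k)) sum4_swap34.
  ring.
have := PQ; set PQs := sum4 _ => PQsE.
suff : 0 <= 3 * sum4 (fun i j k l => P i j k l * P i j k l) - 6 * PQs.
  by rewrite PP PQsE; lra.
have P13 : sum4 (fun i j k l => P i j k l * P i l j k) = - PQs.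
  rewrite -sum4_swap34 -mulN1r -sum4Z; apply: eq_sum4 => i j k l.
  rewrite /P (sA l k) (sB l k); ring.
have P23 : sum4 (fun i j k l => P i k j l * P i l j k) = PQs.
  transitivity (sum4 (fun i j k l => P i l k j * P i k l j)).
    apply: eq_sum4 => i j k l; rewrite mulrC /P.
    by rewrite (sA k j) (sB k j) (sA l j) (sB l j); ring.
  rewrite -(sum4_swap34 (fun i j k l => P i l k j * P i k l j)).
  rewrite -(sum4_swap23 (fun i j k l => P i k l j * P i l k j)).
  by rewrite (sum4_swap34 (fun i j k l => P i j k l * P i k j l)).
have P22 : sum4 (fun i j k l => P i k j l * P i k j l)
           = sum4 (fun i j k l => P i j k l * P i j k l).
  exact: (sum4_swap23 (fun i j k l => P i j k l * P i j k l)).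
have P33 : sum4 (fun i j k l => P i l j k * P i l j k)
           = sum4 (fun i j k l => P i j k l * P i j k l).
  by rewrite -P22 (sum4_swap34 (fun i j k l => P i k j l * P i k j l)).
(* The three square terms have equal sums, and each of the three cross terms contributes -2
   [PQs]. *)
have -> : 3 * sum4 (fun i j k l => P i j k l * P i j k l) - 6 * PQs
  = sum4 (fun i j k l => (P i j k l - P i k j l + P i l j k) ^+ 2).
  rewrite (@eq_sum4 _ _ (fun i j k l => (P i j k l - _ + _) ^+ 2)
    (fun i j k l => (P i j k l * P i j k l + P i k j l * P i k j l
      + P i l j k * P i l j k)
      + ((- 2) * (P i j k l * P i k j l) + 2 * (P i j k l * P i l j k)
      + (- 2) * (P i k j l * P i l j k)))); last by move=> i j k l; ring.
  rewrite !sum4D !sum4Z P22 P33 P13 P23 -/PQs; ring.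
by do 4!(apply: sumr_ge0 => ? _); exact: sqr_ge0.
Qed.

(** Parallelogram law; |B A| = |A B| because B A = (A B)^T. *)
Lemma skew_frob2_mul_comm (R : realType) (p : nat) (A B : 'M[R]_p) :
  A^T = - A -> B^T = - B ->
  frob2 (A *m B - B *m A) = 4 * frob2 (A *m B) - frob2 (A *m B + B *m A).
Proof.
move=> sA sB; have : frob2 (B *m A) = frob2 (A *m B).
  by rewrite -frob2_tr trmx_mul sA sB mulmxN mulNmx opprK.
rewrite !frob2E !fdot_linE (fdotC (B *m A) (A *m B)); lra.
Qed.

Lemma skew_commutator_le_orth (R : realType) (p : nat) (A B : 'M[R]_p) :
  A^T = - A -> B^T = - B ->
  frob2 (A *m B - B *m A) <= frob2 A * frob2 B + fdot A B ^+ 2.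
Proof.
move=> sA sB; rewrite skew_frob2_mul_comm //.
by rewrite (le_trans _ (skew_frob2_mul_le sA sB)) // lerBlDr lerDl frob2_ge0.
Qed.

(* Replace B by its component orthogonal to A. *)
Lemma skew_commutator_le (R : realType) (p : nat) (A B : 'M[R]_p) :
  A^T = - A -> B^T = - B ->
  frob2 (A *m B - B *m A) <= frob2 A * frob2 B.
Proof.
move=> sA sB; have [/frob2_eq0 ->|nz] := eqVneq (frob2 A) 0.
  by rewrite mul0mx mulmx0 subrr frob20 mul0r.
have pos : 0 < frob2 A by rewrite lt0r nz frob2_ge0.
pose t := fdot A B / frob2 A; pose B' : 'M[R]_p := B - t *: A.
have sB' : B'^T = - B' by rewrite linearB linearZ /= sA sB scalerN opprB opprK addrC.
have AB' : fdot A B' = 0.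
  by rewrite /B' !fdot_linE -frob2E /t; field.
have -> : A *m B - B *m A = A *m B' - B' *m A.
  rewrite mulmxBr mulmxBl -scalemxAl -scalemxAr opprB.
  by rewrite addrA subrK.
rewrite (le_trans (skew_commutator_le_orth sA sB')) // AB' expr0n addr0.
rewrite ler_wpM2l ?frob2_ge0 //.
have -> : B = B' + t *: A by rewrite subrK.
clear sB'; move: B' AB' => C AC.
rewrite [leRHS]frob2E !fdot_linE (fdotC C) AC -!frob2E !mulr0 !add0r addr0.
by rewrite lerDl mulrA mulr_ge0 ?frob2_ge0 // -expr2 sqr_ge0.
Qed.

(** With w = b A, which is orthogonal to b, the matrix (b^T w - w^T b) / |b|^2 is the projection of
    A onto the line of b^T w - w^T b, and its squared norm is 2 |w|^2 / |b|^2. *)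
Lemma skew_row_mul_le (R : realType) (p : nat) (A : 'M[R]_p) (b : 'rV[R]_p) :
  A^T = - A -> 2 * frob2 (b *m A) <= frob2 b * frob2 A.
Proof.
move=> sA; pose w := b *m A.
have [/frob2_eq0 ->|nz] := eqVneq (frob2 b) 0.
  by rewrite mul0mx !frob20 mulr0 mul0r.
have pos : 0 < frob2 b by rewrite lt0r nz frob2_ge0.
have bw : fdot b w = 0.
  suff : fdot b w = - fdot b w by lra.
  rewrite {1}/fdot mxtrace_mulC -mxtrace_tr trmx_mul trmxK.
  by rewrite {1}/w trmx_mul sA mulNmx mulmxN linearN /= mulmxA mxtrace_mulC.
have Abw : fdot A (b^T *m w) = frob2 w.
  rewrite /fdot sA mulNmx linearN /= mulmxA mxtrace_mulC.
  have -> : A *m b^T = - w^T by rewrite /w trmx_mul sA mulNmx opprK.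
  by rewrite mulmxN linearN /= mxtrace_mulC opprK /frob2.
have Awb : fdot A (w^T *m b) = - frob2 w.
  by rewrite -Abw -fdot_tr sA fdotNl trmx_mul trmxK.
have bwwb : fdot (b^T *m w) (w^T *m b) = 0.
  rewrite /fdot trmx_mul trmxK -mulmxA (mulmxA b) fdot_row bw.
  by rewrite raddf0 mul0mx mulmx0 linear0.
(* The residual of this projection, scaled by |b|^2, has squared norm |b|^2 (|b|^2 |A|^2 - 2
   |w|^2). *)
have := frob2_ge0 (frob2 b *: A - b^T *m w + w^T *m b).
rewrite frob2E !fdot_linE (fdotC (w^T *m b) (b^T *m w)) bwwb.
rewrite (fdotC (b^T *m w) A) (fdotC (w^T *m b) A) Abw Awb -!frob2E !frob2_outer !frob2_tr => H.
rewrite -subr_ge0 -(pmulr_rge0 _ pos); move: H; congr (0 <= _); ring.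
Qed.

(** * The Gauss equation *)

Lemma frob2_subtr (R : realType) (p : nat) (M : 'M[R]_p) :
  frob2 (M - M^T) = 2 * frob2 M - 2 * \tr (M *m M).
Proof.
rewrite frob2E !fdot_linE -!frob2E frob2_tr (fdotC M^T) {1 2}/fdot.
by rewrite -trmx_mul mxtrace_tr; ring.
Qed.

Lemma frob2_addtr (R : realType) (p : nat) (M : 'M[R]_p) :
  frob2 (M + M^T) = 2 * frob2 M + 2 * \tr (M *m M).
Proof.
rewrite frob2E !fdot_linE -!frob2E frob2_tr (fdotC M^T) {1 2}/fdot.
by rewrite -trmx_mul mxtrace_tr; ring.
Qed.

(** Only the Gram matrices of X and Y enter, and these split along the blocks of a tangent
    vector. *)
Lemma frob2_mul_gram (R : realType) (m k l : nat)
    (X : 'M[R]_(m, k)) (Y : 'M[R]_(l, k)) :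
  frob2 (X *m Y^T) = \tr (X^T *m X *m (Y^T *m Y)).
Proof.
by rewrite /frob2 trmx_mul trmxK -!mulmxA mxtrace_mulC !mulmxA.
Qed.

(* Gauss equation: the second fundamental form of the Stiefel manifold is
   II(X, Y) = - U (X^T Y + Y^T X) / 2. *)
Lemma sec_curv_gauss (R : realType) (p q : nat) (X Y : 'M[R]_(p + q, p)) :
  tangent X -> tangent Y ->
  sec_curv X Y = frob2 (X *m Y^T) - 4^-1 * frob2 (X^T *m Y + Y^T *m X).
Proof.
rewrite -[X]vsubmxK -[Y]vsubmxK /tangent /sec_curv frob2_mul_gram.
rewrite !col_mxKu !col_mxKd.
move: (usubmx X) (usubmx Y) (dsubmx X) (dsubmx Y) => A1 A2 B1 B2 {X Y}.
move=> sA1 sA2; rewrite !tr_col_mx !mul_row_col sA1 sA2 !mulNmx.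
(* Both sides become traces of products in [P], [Q], [G], [N], A1 and A2, compared by cyclicity and
   transposition. *)
pose P := B1^T *m B1; pose Q := B2^T *m B2.
pose G := A1 *m A2; pose N := B1^T *m B2.
have NT : N^T = B2^T *m B1 by rewrite trmx_mul trmxK.
have GT : G^T = A2 *m A1 by rewrite trmx_mul sA1 sA2 mulmxN mulNmx opprK.
rewrite -/P -/Q -/N -NT -/G -GT.
rewrite (_ : (G - G^T) - (N^T - N) = (G + N) - (G + N)^T); last first.
  by rewrite [(G + N)^T]linearD /= opprB opprD addrACA.
rewrite [X in _ - 4^-1 * frob2 X](_ : _ = (N - G) + (N - G)^T); last first.
  by rewrite [(N - G)^T]linearB /= (addrC N) (addrC N^T).
have -> : B1 *m B2^T - B2 *m B1^T = (B1 *m B2^T) - (B1 *m B2^T)^T.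
  by rewrite trmx_mul trmxK.
rewrite !frob2_subtr frob2_addtr frob2_mul_gram -/P -/Q.
have -> : \tr (B1 *m B2^T *m (B1 *m B2^T)) = \tr (N *m N).
  by rewrite -(mxtrace_tr (N *m N)) trmx_mul NT -!mulmxA mxtrace_mulC !mulmxA.
have EE : frob2 (B1 *m A2 - B2 *m A1)
    = - \tr (P *m (A2 *m A2)) + 2 * \tr (G *m N) - \tr (A1 *m A1 *m Q).
  rewrite frob2E !fdot_linE -!frob2E (fdotC (B2 *m A1)).
  have -> : frob2 (B1 *m A2) = - \tr (P *m (A2 *m A2)).
    rewrite /frob2 trmx_mul sA2 !mulNmx linearN /= -!mulmxA mxtrace_mulC.
    by rewrite !mulmxA.
  have -> : frob2 (B2 *m A1) = - \tr (A1 *m A1 *m Q).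
    rewrite /frob2 trmx_mul sA1 !mulNmx linearN /= mulmxA mxtrace_mulC.
    by rewrite !mulmxA.
  have -> : fdot (B1 *m A2) (B2 *m A1) = - \tr (G *m N).
    rewrite /fdot trmx_mul sA2 !mulNmx linearN /= mulmxA mxtrace_mulC.
    by rewrite !mulmxA.
  ring.
have AA : \tr (A1 *m A1 *m (A2 *m A2)) = frob2 G.
  by rewrite /frob2 GT /G -!mulmxA [in RHS]mxtrace_mulC !mulmxA.
rewrite EE.
rewrite [frob2 (G + N)]frob2E [frob2 (N - G)]frob2E !fdot_linE -!frob2E (fdotC N G).
rewrite !(mulmxDl, mulmxDr, mulNmx, mulmxN) !(linearD, linearN) /=.
rewrite AA (mxtrace_mulC N G); by field.
Qed.

(* The right-hand side of the Gauss equation, for matrices of any size. *)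
Definition ecurv (R : realType) (m k : nat) (X Y : 'M[R]_(m, k)) : R :=
  frob2 (X *m Y^T) - 4^-1 * frob2 (X^T *m Y + Y^T *m X).

(** Only the last term is negative, which shows the lower bound. The symmetric part of X^T Y is
    traded for the skew part of X Y^T, as the squares of X^T Y and X Y^T have equal traces. *)
Lemma ecurvE (R : realType) (m k : nat) (X Y : 'M[R]_(m, k)) :
  ecurv X Y = 2^-1 * frob2 (X *m Y^T) + 4^-1 * frob2 (X *m Y^T - Y *m X^T)
              - 2^-1 * frob2 (X^T *m Y).
Proof.
rewrite /ecurv.
have -> : Y *m X^T = (X *m Y^T)^T by rewrite trmx_mul trmxK.
have -> : Y^T *m X = (X^T *m Y)^T by rewrite trmx_mul trmxK.
rewrite frob2_subtr frob2_addtr.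
have -> : \tr (X *m Y^T *m (X *m Y^T)) = \tr (X^T *m Y *m (X^T *m Y)).
  rewrite -mxtrace_tr !trmx_mul !trmxK -!mulmxA mxtrace_mulC.
  by rewrite !mulmxA.
by field.
Qed.

(** * Curvature bounds and their equality cases *)

Lemma frob2_mul_tr_le (R : realType) (m k l : nat)
    (X : 'M[R]_(m, k)) (Y : 'M[R]_(l, k)) :
  frob2 (X *m Y^T) <= frob2 X * frob2 Y.
Proof. by rewrite -(frob2_tr X) -(frob2_tr Y) -{1}(trmxK X) frob2_mul_le. Qed.

Lemma ecurv_le1 (R : realType) (m k : nat) (X Y : 'M[R]_(m, k)) :
  frob2 X = 1 -> frob2 Y = 1 -> ecurv X Y <= 1.
Proof.
move=> X1 Y1; have := frob2_mul_tr_le X Y; rewrite X1 Y1 /ecurv.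
have := frob2_ge0 (X^T *m Y + Y^T *m X); lra.
Qed.

Lemma ecurv_geN2V (R : realType) (m k : nat) (X Y : 'M[R]_(m, k)) :
  frob2 X = 1 -> frob2 Y = 1 -> - 2^-1 <= ecurv X Y.
Proof.
move=> X1 Y1; have := frob2_mul_le X Y; rewrite X1 Y1 ecurvE.
have := frob2_ge0 (X *m Y^T); have := frob2_ge0 (X *m Y^T - Y *m X^T); lra.
Qed.

(** Equality forces |X Y^T| = 1; the rank-one lemma then applies to the transposes. *)
Lemma ecurv_eq1 (R : realType) (m k : nat) (X Y : 'M[R]_(m, k)) :
  frob2 X = 1 -> frob2 Y = 1 -> ecurv X Y = 1 ->
  exists (u v : 'rV[R]_m) (x : 'rV[R]_k),
    [/\ X = u^T *m x, Y = v^T *m x, frob2 u = 1, frob2 v = 1 & frob2 x = 1].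
Proof.
move=> X1 Y1 XY1; have XYT : frob2 (X *m Y^T) = 1.
  move: XY1; have := frob2_mul_tr_le X Y; rewrite X1 Y1 /ecurv.
  have := frob2_ge0 (X^T *m Y + Y^T *m X); lra.
have [|||x [u [v [Xe Ye x1 u1 v1]]]] := @frob2_mul_eq1 _ _ _ _ X^T Y^T;
  rewrite ?frob2_tr ?trmxK //.
exists u, v, x^T; split; rewrite ?frob2_tr //.
  by rewrite -[X]trmxK Xe trmx_mul.
by rewrite -[Y]trmxK Ye trmx_mul.
Qed.

(** In [ecurvE] the nonnegative terms leave no room unless |X^T Y| = 1. *)
Lemma ecurv_eqN2V (R : realType) (m k : nat) (X Y : 'M[R]_(m, k)) :
  frob2 X = 1 -> frob2 Y = 1 -> ecurv X Y = - 2^-1 ->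
  exists (u : 'rV[R]_m) (x y : 'rV[R]_k),
    [/\ X = u^T *m x, Y = u^T *m y, frob2 u = 1, frob2 x = 1 & frob2 y = 1].
Proof.
move=> X1 Y1 XY1; have XTY : frob2 (X^T *m Y) = 1.
  move: XY1; have := frob2_mul_le X Y; rewrite X1 Y1 ecurvE.
  have := frob2_ge0 (X *m Y^T); have := frob2_ge0 (X *m Y^T - Y *m X^T); lra.
have [u [x [y [Xe Ye u1 x1 y1]]]] := frob2_mul_eq1 X1 Y1 XTY.
by exists u^T, x, y; rewrite trmxK frob2_tr.
Qed.

(** * Curvature of rank-one pairs and orthogonal invariance *)

Lemma fdot_outer (R : realType) (m k : nat) (u v : 'rV[R]_m) (x y : 'rV[R]_k) :
  fdot (u^T *m x) (v^T *m y) = fdot u v * fdot x y.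
Proof.
rewrite /fdot trmx_mul trmxK -mulmxA (mulmxA u) fdot_row mul_scalar_mx.
by rewrite -scalemxAr linearZ.
Qed.

Lemma frob2_outer_tr (R : realType) (m k : nat) (u : 'rV[R]_m) (x : 'rV[R]_k) :
  frob2 (u^T *m x) = frob2 u * frob2 x.
Proof. exact: fdot_outer. Qed.

(** Here X^T Y = 0, so only |X Y^T|^2 remains. *)
Lemma ecurv_common_row (R : realType) (m k : nat) (u v : 'rV[R]_m) (x : 'rV[R]_k) :
  frob2 u = 1 -> frob2 v = 1 -> fdot u v = 0 -> frob2 x = 1 ->
  ecurv (u^T *m x) (v^T *m x) = 1.
Proof.
move=> u1 v1 uv x1; rewrite /ecurv !trmx_mul !trmxK.
rewrite -!mulmxA (mulmxA x) (mulmxA u) (mulmxA v) !fdot_row (fdotC v) uv.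
rewrite raddf0 !mul0mx !mulmx0 addr0 frob20 -frob2E x1 mul_scalar_mx scale1r.
by rewrite frob2_outer_tr u1 v1 mulr1 mulr0 subr0.
Qed.

(** Here X Y^T = 0, so only - |X^T Y|^2 / 2 remains. *)
Lemma ecurv_common_col (R : realType) (m k : nat) (u : 'rV[R]_m) (x y : 'rV[R]_k) :
  frob2 u = 1 -> frob2 x = 1 -> frob2 y = 1 -> fdot x y = 0 ->
  ecurv (u^T *m x) (u^T *m y) = - 2^-1.
Proof.
move=> u1 x1 y1 xy; rewrite ecurvE !trmx_mul !trmxK.
rewrite -!mulmxA (mulmxA x) (mulmxA y) (mulmxA u) !fdot_row (fdotC y) xy.
rewrite raddf0 !mul0mx !mulmx0 subr0 frob20 -frob2E u1 mul_scalar_mx scale1r.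
by rewrite frob2_outer_tr x1 y1 !mulr0 add0r !mulr1 sub0r.
Qed.

Lemma frob2_orthogonal (R : realType) (m k : nat) (U : 'M[R]_m) (V : 'M[R]_k)
    (M : 'M[R]_(m, k)) :
  orthogonal_mx U -> orthogonal_mx V -> frob2 (U^T *m M *m V) = frob2 M.
Proof.
move=> /mulmx1C oU /mulmx1C oV.
rewrite /frob2 !trmx_mul trmxK -!mulmxA mxtrace_mulC.
by rewrite -!mulmxA oV mulmx1 (mulmxA U) oU mul1mx.
Qed.

(** X Y^T is conjugated by U and X^T Y by V, which preserves the norms. *)
Lemma ecurv_orthogonal (R : realType) (m k : nat) (U : 'M[R]_m) (V : 'M[R]_k)
    (X Y : 'M[R]_(m, k)) :
  orthogonal_mx U -> orthogonal_mx V ->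
  ecurv (U^T *m X *m V) (U^T *m Y *m V) = ecurv X Y.
Proof.
move=> oU oV; have /mulmx1C oU' := oU; have /mulmx1C oV' := oV.
rewrite /ecurv !trmx_mul !trmxK.
have E (Z T : 'M[R]_(m, k)) :
    V^T *m (Z^T *m U) *m (U^T *m T *m V) = V^T *m (Z^T *m T) *m V.
  by rewrite -!mulmxA (mulmxA U) oU' mul1mx.
rewrite !E -mulmxDl -mulmxDr frob2_orthogonal //.
rewrite (_ : _ *m _ = U^T *m (X *m Y^T) *m U) ?frob2_orthogonal //.
by rewrite -!mulmxA (mulmxA V) oV' mul1mx.
Qed.

(** * Block decomposition of tangent vectors *)

Lemma metric_blocks (R : realType) (p q : nat) (X Y : 'M[R]_(p + q, p)) :
  metric X Y = fdot (usubmx X) (usubmx Y) + fdot (dsubmx X) (dsubmx Y).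
Proof.
rewrite /metric -{1}[X]vsubmxK -{1}[Y]vsubmxK tr_col_mx mul_row_col.
by rewrite linearD.
Qed.

Lemma metric_dsubmx (R : realType) (p q : nat) (X Y : 'M[R]_(p + q, p)) :
  usubmx X = 0 -> metric X Y = fdot (dsubmx X) (dsubmx Y).
Proof. by rewrite metric_blocks => ->; rewrite /fdot trmx0 mul0mx linear0 add0r. Qed.

Lemma sec_curvE (R : realType) (p q : nat) (X Y : 'M[R]_(p + q, p)) :
  orthonormal_tangent X Y -> sec_curv X Y = ecurv X Y.
Proof. by case=> tX tY _ _ _; rewrite sec_curv_gauss. Qed.

Lemma ecurv_dsubmx (R : realType) (p q : nat) (X Y : 'M[R]_(p + q, p)) :
  usubmx X = 0 -> usubmx Y = 0 -> ecurv X Y = ecurv (dsubmx X) (dsubmx Y).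
Proof.
move=> X0 Y0; rewrite /ecurv !frob2_mul_gram.
have E (Z T : 'M[R]_(p + q, p)) :
    usubmx Z = 0 -> Z^T *m T = (dsubmx Z)^T *m dsubmx T.
  move=> Z0; rewrite -{1}[Z]vsubmxK -{1}[T]vsubmxK tr_col_mx mul_row_col.
  by rewrite Z0 trmx0 mul0mx add0r.
by rewrite !E.
Qed.

Lemma tangent_outer (R : realType) (p q : nat) (u : 'rV[R]_(p + q)) (x : 'rV[R]_p) :
  tangent (u^T *m x) -> usubmx (u^T *m x) = 0.
Proof. by rewrite /tangent -mul_usub_mx; exact: skew_outer_eq0. Qed.

Lemma tangentB_tangent (R : realType) (p q : nat) (B : 'M[R]_(q, p)) :
  tangent (tangentB B).
Proof. by rewrite /tangent col_mxKu trmx0 oppr0. Qed.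

Lemma orthonormal_tangentB (R : realType) (p q : nat) (B C : 'M[R]_(q, p)) :
  frob2 B = 1 -> frob2 C = 1 -> fdot B C = 0 ->
  orthonormal_tangent (tangentB B) (tangentB C).
Proof.
move=> B1 C1 BC; split; try exact: tangentB_tangent;
  by rewrite metric_dsubmx ?col_mxKu // !col_mxKd.
Qed.

(** * Planes spanned by matrix units *)

Lemma elem_mxE (R : realType) (m k a b : nat) (a_lt : (a < m)%N) (b_lt : (b < k)%N) :
  elem_mx a b = delta_mx (Ordinal a_lt) (Ordinal b_lt) :> 'M[R]_(m, k).
Proof. by apply/matrixP => i j; rewrite !mxE. Qed.

Lemma delta_outer (R : realType) (m k : nat) (i : 'I_m) (j : 'I_k) :
  delta_mx i j = (delta_mx 0 i : 'rV[R]_m)^T *m (delta_mx 0 j : 'rV[R]_k).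
Proof. by rewrite trmx_delta mul_delta_mx. Qed.

Lemma fdot_delta (R : realType) (m k : nat) (i i' : 'I_m) (j j' : 'I_k) :
  fdot (delta_mx i j) (delta_mx i' j') = ((i == i') && (j == j'))%:R :> R.
Proof.
rewrite fdotE (bigD1 i) //= (bigD1 j) //= !mxE !eqxx mul1r.
rewrite big1 ?addr0 => [|l /negbTE lj]; last by rewrite !mxE lj andbF mul0r.
rewrite big1 ?addr0 // => l /negbTE li.
by rewrite big1 // => l' _; rewrite !mxE li mul0r.
Qed.

Lemma frob2_delta (R : realType) (m k : nat) (i : 'I_m) (j : 'I_k) :
  frob2 (delta_mx i j) = 1 :> R.
Proof. by rewrite frob2E fdot_delta !eqxx. Qed.

Lemma sec_curv_bounds (R : realType) (p q : nat) (X Y : 'M[R]_(p + q, p)) :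
  orthonormal_tangent X Y -> - 2^-1 <= sec_curv X Y <= 1.
Proof.
move=> oXY; rewrite sec_curvE //; case: oXY => _ _ X1 Y1 _.
by rewrite ecurv_geN2V ?ecurv_le1.
Qed.

Lemma orthonormal_tangentB_elem_row (R : realType) (p q : nat) :
  (1 < q)%N -> (0 < p)%N ->
  let X : 'M[R]_(p + q, p) := tangentB (elem_mx 1 0) in
  let Y : 'M[R]_(p + q, p) := tangentB (elem_mx 0 0) in
  orthonormal_tangent X Y /\ sec_curv X Y = 1.
Proof.
move=> q1 p0 /=; rewrite (elem_mxE R q1 p0) (elem_mxE R (ltnW q1) p0).
have oXY := orthonormal_tangentB (frob2_delta R (Ordinal q1) (Ordinal p0))
  (frob2_delta R (Ordinal (ltnW q1)) (Ordinal p0)) (fdot_delta R _ _ _ _).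
split=> //; rewrite sec_curvE // ecurv_dsubmx ?col_mxKu // !col_mxKd.
rewrite (delta_outer R (Ordinal q1) (Ordinal p0)).
rewrite (delta_outer R (Ordinal (ltnW q1)) (Ordinal p0)).
by rewrite ecurv_common_row ?frob2_delta ?fdot_delta.
Qed.

Lemma orthonormal_tangentB_elem_col (R : realType) (p q : nat) :
  (0 < q)%N -> (1 < p)%N ->
  let X : 'M[R]_(p + q, p) := tangentB (elem_mx 0 1) in
  let Y : 'M[R]_(p + q, p) := tangentB (elem_mx 0 0) in
  orthonormal_tangent X Y /\ sec_curv X Y = - 2^-1.
Proof.
move=> q0 p1 /=; rewrite (elem_mxE R q0 p1) (elem_mxE R q0 (ltnW p1)).
have oXY := orthonormal_tangentB (frob2_delta R (Ordinal q0) (Ordinal p1))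
  (frob2_delta R (Ordinal q0) (Ordinal (ltnW p1))) (fdot_delta R _ _ _ _).
split=> //; rewrite sec_curvE // ecurv_dsubmx ?col_mxKu // !col_mxKd.
rewrite (delta_outer R (Ordinal q0) (Ordinal p1)).
rewrite (delta_outer R (Ordinal q0) (Ordinal (ltnW p1))).
by rewrite ecurv_common_col ?frob2_delta ?fdot_delta.
Qed.

(** * Classification of the extremal planes *)

Lemma trace_preserving_sec_curv (R : realType) (p q : nat)
    (X Y X' Y' : 'M[R]_(p + q, p)) :
  orthonormal_tangent X Y -> orthonormal_tangent X' Y' ->
  usubmx X = 0 -> usubmx Y = 0 -> usubmx X' = 0 -> usubmx Y' = 0 ->
  trace_preserving_equiv (dsubmx X) (dsubmx Y) (dsubmx X') (dsubmx Y') ->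
  sec_curv X Y = sec_curv X' Y'.
Proof.
move=> oXY oXY' X0 Y0 X0' Y0' [U [V [oU oV eX eY]]].
rewrite !sec_curvE // (ecurv_dsubmx X0 Y0) (ecurv_dsubmx X0' Y0') -eX -eY.
by rewrite ecurv_orthogonal.
Qed.

Lemma mulmx_outer (R : realType) (m k : nat) (U : 'M[R]_m) (V : 'M[R]_k)
    (u : 'rV[R]_m) (x : 'rV[R]_k) :
  U^T *m (u^T *m x) *m V = (u *m U)^T *m (x *m V).
Proof. by rewrite trmx_mul !mulmxA. Qed.

Lemma sec_curv_eq1 (R : realType) (p q : nat) (X Y : 'M[R]_(p + q, p)) :
  (1 < q)%N -> (0 < p)%N -> orthonormal_tangent X Y ->
  sec_curv X Y = 1 <->
  [/\ usubmx X = 0, usubmx Y = 0 &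
      trace_preserving_equiv (dsubmx X) (dsubmx Y) (elem_mx 1 0) (elem_mx 0 0)].
Proof.
move=> q1 p0 oXY; have [oM eM] := @orthonormal_tangentB_elem_row R p q q1 p0.
split=> [XY1|[X0 Y0 eqv]]; last first.
  rewrite -eM; apply: trace_preserving_sec_curv; rewrite ?col_mxKu //.
  by rewrite !col_mxKd.
have [tX tY X1 Y1 XY] := oXY; rewrite sec_curvE // in XY1.
have [u [v [x [eX eY _ _ _]]]] := ecurv_eq1 X1 Y1 XY1.
have X0 : usubmx X = 0 by rewrite eX tangent_outer -?eX.
have Y0 : usubmx Y = 0 by rewrite eY tangent_outer -?eY.
split=> //; rewrite ecurv_dsubmx // in XY1.
rewrite !metric_dsubmx // in X1 Y1 XY.
(* The first factorization only removed the A-blocks; this one factors the B-blocks, on whose rows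
   and columns U and V act. *)
have [{eX} {}u [{eY} {}v [{}x [eX eY u1 v1 x1]]]] := ecurv_eq1 X1 Y1 XY1.
have uv : fdot u v = 0.
  by rewrite -XY eX eY fdot_outer -frob2E x1 mulr1.
pose d m (i : 'I_m) : 'rV[R]_m := delta_mx 0 i.
have [||V [oV xV _]] := @householder R p x (d _ (Ordinal p0)); rewrite ?frob2_delta //.
have [|||||| U [oU uU vU]] := @orthogonal_pair R q u v
  (d _ (Ordinal q1)) (d _ (Ordinal (ltnW q1))); rewrite ?frob2_delta ?fdot_delta //.
exists U, V; rewrite eX eY !mulmx_outer xV uU vU -!delta_outer -!elem_mxE.
by split.
Qed.

(** As for the maximum with rows and columns exchanged: now V moves an orthonormal pair and U a
    single vector. *)
Lemma sec_curv_eqN2V (R : realType) (p q : nat) (X Y : 'M[R]_(p + q, p)) :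
  (0 < q)%N -> (1 < p)%N -> orthonormal_tangent X Y ->
  sec_curv X Y = - 2^-1 <->
  [/\ usubmx X = 0, usubmx Y = 0 &
      trace_preserving_equiv (dsubmx X) (dsubmx Y) (elem_mx 0 1) (elem_mx 0 0)].
Proof.
move=> q0 p1 oXY; have [oM eM] := @orthonormal_tangentB_elem_col R p q q0 p1.
split=> [XY1|[X0 Y0 eqv]]; last first.
  rewrite -eM; apply: trace_preserving_sec_curv; rewrite ?col_mxKu //.
  by rewrite !col_mxKd.
have [tX tY X1 Y1 XY] := oXY; rewrite sec_curvE // in XY1.
have [u [x [y [eX eY _ _ _]]]] := ecurv_eqN2V X1 Y1 XY1.
have X0 : usubmx X = 0 by rewrite eX tangent_outer -?eX.
have Y0 : usubmx Y = 0 by rewrite eY tangent_outer -?eY.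
split=> //; rewrite ecurv_dsubmx // in XY1.
rewrite !metric_dsubmx // in X1 Y1 XY.
have [{eX} {}u [{eY} {}x [{}y [eX eY u1 x1 y1]]]] := ecurv_eqN2V X1 Y1 XY1.
have xy : fdot x y = 0.
  by rewrite -XY eX eY fdot_outer -frob2E u1 mul1r.
pose d m (i : 'I_m) : 'rV[R]_m := delta_mx 0 i.
have [||U [oU uU _]] := @householder R q u (d _ (Ordinal q0)); rewrite ?frob2_delta //.
have [|||||| V [oV xV yV]] := @orthogonal_pair R p x y
  (d _ (Ordinal p1)) (d _ (Ordinal (ltnW p1))); rewrite ?frob2_delta ?fdot_delta //.
exists U, V; rewrite eX eY !mulmx_outer xV uU yV -!delta_outer -!elem_mxE.
by split.
Qed.

(** * The sphere (p = 1) and the orthogonal group (p = n) *)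

(** X^T Y is the 1 x 1 matrix <X, Y> = 0, and |X Y^T| = |X| |Y| for column vectors. *)
Lemma sec_curv_sphere (R : realType) (q : nat) (X Y : 'M[R]_(1 + q, 1)) :
  orthonormal_tangent X Y -> sec_curv X Y = 1.
Proof.
move=> oXY; rewrite sec_curvE //; case: oXY => _ _ X1 Y1 XY.
rewrite /ecurv frob2_outer frob2_tr -[frob2 X]/(metric X X) X1.
rewrite -[frob2 Y]/(metric Y Y) Y1.
have XTY : X^T *m Y = 0.
  apply/matrixP => i j; rewrite !ord1 [RHS]mxE -XY.
  by rewrite /metric /mxtrace big_ord1.
have -> : Y^T *m X = (X^T *m Y)^T by rewrite trmx_mul trmxK.
by rewrite XTY trmx0 addr0 frob20 mulr0 subr0 mulr1.
Qed.

(** An equation is assumed because n - p does not reduce to 0 for symbolic n = p. *)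
Lemma mx_norows (R : realType) (m k : nat) (M : 'M[R]_(m, k)) : m = 0%N -> M = 0.
Proof. by move=> m0; subst m; exact: flatmx0. Qed.

Lemma sec_curv_norows (R : realType) (p q : nat) (X Y : 'M[R]_(p + q, p)) :
  q = 0%N -> sec_curv X Y =
    4^-1 * frob2 (usubmx X *m usubmx Y - usubmx Y *m usubmx X).
Proof.
move=> q0; rewrite /sec_curv (mx_norows (dsubmx X) q0) (mx_norows (dsubmx Y) q0).
by rewrite !mul0mx !trmx0 !mulmx0 !subr0 !frob20 !mulr0 subr0 !add0r.
Qed.

Lemma metric_norows (R : realType) (p q : nat) (X Y : 'M[R]_(p + q, p)) :
  q = 0%N -> metric X Y = fdot (usubmx X) (usubmx Y).
Proof.
move=> q0; rewrite metric_blocks (mx_norows (dsubmx X) q0).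
by rewrite {2}/fdot trmx0 mul0mx linear0 addr0.
Qed.

Lemma sec_curv_SO (R : realType) (p q : nat) (X Y : 'M[R]_(p + q, p)) :
  q = 0%N -> orthonormal_tangent X Y -> 0 <= sec_curv X Y <= 4^-1.
Proof.
move=> q0 [tX tY]; rewrite !metric_norows // sec_curv_norows // => X1 Y1 _.
have := skew_commutator_le tX tY.
rewrite [frob2 (usubmx X)]X1 [frob2 (usubmx Y)]Y1.
have := frob2_ge0 (usubmx X *m usubmx Y - usubmx Y *m usubmx X); lra.
Qed.

Lemma sum2E (R : realType) (F : 'I_2 -> R) : \sum_i F i = F 0 + F 1.
Proof. by rewrite !big_ord_recl big_ord0 addr0; congr (_ + F _); apply: val_inj. Qed.

Lemma sum3E (R : realType) (F : 'I_3 -> R) : \sum_i F i = F 0 + F 1 + F 2%:R.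
Proof.
rewrite !big_ord_recl big_ord0 addr0 addrA.
by congr (_ + F _ + F _); apply: val_inj.
Qed.

(* The commutator of so(3) is the cross product, with |A|^2 = 2 |a|^2. *)
Lemma skew3_commutator (R : realType) (A B : 'M[R]_3) :
  A^T = - A -> B^T = - B ->
  frob2 (A *m B - B *m A) = 2^-1 * (frob2 A * frob2 B - fdot A B ^+ 2).
Proof.
move=> /matrixP skA /matrixP skB.
have sA i j : A i j = - A j i by have := skA j i; rewrite !mxE.
have sB i j : B i j = - B j i by have := skB j i; rewrite !mxE.
have dA i : A i i = 0 by have := sA i i; lra.
have dB i : B i i = 0 by have := sB i i; lra.
rewrite !frob2E !fdotE; do !rewrite !sum3E ?mxE.
rewrite !dA !dB (sA 1 0) (sA 2%:R 0) (sA 2%:R 1) (sB 1 0) (sB 2%:R 0) (sB 2%:R 1).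
by field.
Qed.

Lemma sec_curv_SO3 (R : realType) (q : nat) (X Y : 'M[R]_(3 + q, 3)) :
  q = 0%N -> orthonormal_tangent X Y -> sec_curv X Y = 8^-1.
Proof.
move=> q0 [tX tY]; rewrite !metric_norows // sec_curv_norows // => X1 Y1 XY.
by rewrite skew3_commutator // !frob2E X1 Y1 XY; field.
Qed.

(** * The case p = n - 1 *)

Lemma skew2_commutator (R : realType) (A B : 'M[R]_2) :
  A^T = - A -> B^T = - B -> A *m B - B *m A = 0.
Proof.
move=> /matrixP skA /matrixP skB; apply: frob2_eq0.
have sA i j : A i j = - A j i by have := skA j i; rewrite !mxE.
have sB i j : B i j = - B j i by have := skB j i; rewrite !mxE.
have dA i : A i i = 0 by have := sA i i; lra.
have dB i : B i i = 0 by have := sB i i; lra.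
rewrite !frob2E !fdotE; do !rewrite !sum2E ?mxE.
rewrite !dA !dB (sA 1 0) (sB 1 0); ring.
Qed.

(* Maximizing over C = B1^T B2 - B2^T B1 for a fixed commutator of the
   A-blocks gives the last term. *)
Lemma sec_curv_row_le (R : realType) (p : nat) (X Y : 'M[R]_(p + 1, p)) :
  sec_curv X Y <= frob2 (dsubmx X *m usubmx Y - dsubmx Y *m usubmx X)
    + 2^-1 * frob2 (usubmx X *m usubmx Y - usubmx Y *m usubmx X).
Proof.
rewrite /sec_curv.
move: (usubmx X) (usubmx Y) (dsubmx X) (dsubmx Y) => A1 A2 B1 B2.
(* With a single row, B1 B2^T is a scalar and hence symmetric. *)
have -> : B1 *m B2^T - B2 *m B1^T = 0 by rewrite !fdot_row fdotC subrr.
rewrite -(opprB (B1^T *m B2)) opprK frob20.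
set C := B1^T *m B2 - _; set G := A1 *m A2 - _.
move: C G => C G.
(* By the parallelogram law, |G|^2 / 2 exceeds |G + C|^2 / 4 - |C|^2 / 2 by |G - C|^2 / 4. *)
have : 0 <= frob2 (G - C) by exact: frob2_ge0.
rewrite [frob2 (G + C)]frob2E frob2E !fdot_linE -!frob2E (fdotC C G); lra.
Qed.

(* Witnesses: s = |A1| |A2| and t = |b1| |b2|. *)
Lemma mixed_term_le (R : realType) (p : nat) (A1 A2 : 'M[R]_p) (b1 b2 : 'rV[R]_p) :
  A1^T = - A1 -> A2^T = - A2 ->
  frob2 A1 + frob2 b1 = 1 -> frob2 A2 + frob2 b2 = 1 ->
  exists s t : R, [/\ 0 <= s, 0 <= t, s + t <= 1,
    s ^+ 2 = frob2 A1 * frob2 A2 &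
    2 * frob2 (b1 *m A2 - b2 *m A1) <= 1 - (s - t) ^+ 2].
Proof.
move=> sA1 sA2 n1 n2.
pose r (m : nat) (M : 'M[R]_(m, p)) := Num.sqrt (frob2 M).
have r2 m M : @r m M ^+ 2 = frob2 M by rewrite sqr_sqrtr ?frob2_ge0.
have r0 m M : 0 <= @r m M by exact: sqrtr_ge0.
(* Scaling by the square root of 2 absorbs the factor 2 of [skew_row_mul_le]. *)
have bound (A : 'M[R]_p) (b : 'rV[R]_p) : A^T = - A ->
    frob2 (Num.sqrt 2 *: (b *m A)) <= (r _ b * r _ A) ^+ 2.
  move=> sA; rewrite frob2E !fdot_linE -frob2E mulrA -expr2 sqr_sqrtr //.
  by rewrite exprMn !r2 skew_row_mul_le.
have := frob2B_le (mulr_ge0 (r0 _ b1) (r0 _ A2)) (mulr_ge0 (r0 _ b2) (r0 _ A1))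
  (bound _ b1 sA2) (bound _ b2 sA1).
rewrite -scalerBr frob2E fdotZl fdotZr -frob2E mulrA -expr2 sqr_sqrtr // => H.
exists (r _ A1 * r _ A2), (r _ b1 * r _ b2); split; rewrite ?mulr_ge0 //.
(* The arithmetic-geometric mean inequality for each product, with the two normalizations added. *)
- have := r2 _ A1; have := r2 _ A2; have := r2 _ b1; have := r2 _ b2.
  have := sqr_ge0 (r _ A1 - r _ A2); have := sqr_ge0 (r _ b1 - r _ b2); nra.
- by rewrite exprMn !r2.
- apply: (le_trans H); rewrite le_eqVlt; apply/orP; left; apply/eqP.
  have := r2 _ A1; have := r2 _ A2; have := r2 _ b1; have := r2 _ b2.
  move: (r _ A1) (r _ A2) (r _ b1) (r _ b2) => a1 a2 c1 c2 e2 e1 h2 h1.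
  (* Lagrange's identity in the plane for (a1, c1) and (a2, c2); both vectors have norm 1. *)
  transitivity ((a1 ^+ 2 + c1 ^+ 2) * (a2 ^+ 2 + c2 ^+ 2) - (a1 * a2 - c1 * c2) ^+ 2).
    ring.
  by rewrite e2 e1 h2 h1 n1 n2 mulr1.
Qed.

Lemma sec_curv_row_le23 (R : realType) (p q : nat) (X Y : 'M[R]_(p + q, p)) :
  q = 1%N -> orthonormal_tangent X Y -> sec_curv X Y <= 2 / 3.
Proof.
move=> q1; subst q => -[tX tY]; rewrite !metric_blocks -!frob2E => n1 n2 _.
have [s [t [s0 t0 st s2 E]]] := mixed_term_le tX tY n1 n2.
have := sec_curv_row_le X Y; have /= := skew_commutator_le tX tY.
rewrite -s2 => H1 H2; have : 2 * sec_curv X Y <= 1 - (s - t) ^+ 2 + s ^+ 2 by lra.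
(* As s <= 1 - t, the bound 1 + 2 s t - t^2 is at most 1 + 2 t - 3 t^2, whose maximum 4/3 lies at t
   = 1/3. *)
have := sqr_ge0 (t - 3^-1); nra.
Qed.

Lemma sec_curv32_le (R : realType) (X Y : 'M[R]_(2 + 1, 2)) :
  orthonormal_tangent X Y -> sec_curv X Y <= 2^-1.
Proof.
case=> tX tY; rewrite !metric_blocks -!frob2E => n1 n2 _.
have [s [t [_ _ _ _ E]]] := mixed_term_le tX tY n1 n2.
have := sec_curv_row_le X Y; rewrite skew2_commutator // frob20.
have := sqr_ge0 (s - t); lra.
Qed.

(** X lives in the B-block and Y in the A-block, so X^T Y = 0 and the curvature is |X Y^T|^2. *)
Lemma sec_curv32_max (R : realType) :
  let X : 'M[R]_(2 + 1, 2) := - elem_mx 2 0 in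
  let Y : 'M[R]_(2 + 1, 2) := (Num.sqrt 2)^-1 *: (elem_mx 1 0 - elem_mx 0 1) in
  orthonormal_tangent X Y /\ sec_curv X Y = 2^-1.
Proof.
set X : 'M[R]_(2 + 1, 2) := - _; set Y : 'M[R]_(2 + 1, 2) := _ *: _ => /=.
have XE : X = - delta_mx 2%:R 0.
  by rewrite /X (elem_mxE R (isT : (2 < 3)%N) (isT : (0 < 2)%N));
    congr (- delta_mx _ _); apply: val_inj.
have YE : Y = (Num.sqrt 2)^-1 *: (delta_mx 1 0 - delta_mx 0 1).
  rewrite /Y (elem_mxE R (isT : (1 < 3)%N) (isT : (0 < 2)%N)).
  rewrite (elem_mxE R (isT : (0 < 3)%N) (isT : (1 < 2)%N)).
  by congr (_ *: (delta_mx _ _ - delta_mx _ _)); apply: val_inj.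
have c2 : (Num.sqrt 2)^-1 * (Num.sqrt 2)^-1 = 2^-1 :> R.
  by rewrite -invfM -expr2 sqr_sqrtr.
have oXY : orthonormal_tangent X Y.
  split.
  - rewrite /tangent; apply/matrixP => i j; rewrite !mxE /= (ltn_eqF (ltn_ord i)).
    by rewrite (ltn_eqF (ltn_ord j)) !oppr0.
  - rewrite /tangent; apply/matrixP => i j; rewrite !mxE /= -mulrN opprB.
    by rewrite (andbC (j == 1%N :> nat)) (andbC (j == 0%N :> nat)).
  - by rewrite -[metric _ _]/(fdot X X) XE !fdot_linE !fdot_delta opprK.
  - rewrite -[metric _ _]/(fdot Y Y) YE fdotZl fdotZr mulrA c2.
    rewrite !fdot_linE !fdot_delta /=.
    by field.
  - by rewrite -[metric _ _]/(fdot X Y) XE YE !fdot_linE !fdot_delta /=; ring.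
split=> //; rewrite sec_curvE // /ecurv.
have XTY : X^T *m Y = 0.
  rewrite XE YE [(- _)^T]linearN /= trmx_delta mulNmx -scalemxAr mulmxBr.
  by rewrite !mul_delta_mx_cond /= !mulr0n subrr scaler0 oppr0.
have -> : Y^T *m X = (X^T *m Y)^T by rewrite trmx_mul trmxK.
rewrite XTY trmx0 addr0 frob20 mulr0 subr0 XE YE linearZ linearB /= !trmx_delta.
rewrite -scalemxAr mulNmx mulmxBr !mul_delta_mx_cond /= mulr1n mulr0n subr0.
by rewrite frob2E scalerN fdotNl fdotNr fdotZl fdotZr fdot_delta opprK mulr1.
Qed.

Theorem theorem3p8 (R : realType) (n p : nat)
    (p_ge1 : (1 <= p)%N) (p_le_n : (p <= n)%N)
    (dim_ge2 : (2 <= stiefel_dim n p)%N) :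
  (* global bounds *)
  (forall X Y : 'M[R]_(p + (n - p), p), orthonormal_tangent X Y ->
     - 2^-1 <= sec_curv X Y <= 1)
  /\
  (* item 1 *)
  ((2 <= p)%N -> (p + 2 <= n)%N ->
     let Xmax : 'M[R]_(p + (n - p), p) := tangentB (elem_mx 1 0) in
     let Ymax : 'M[R]_(p + (n - p), p) := tangentB (elem_mx 0 0) in
     let Xmin : 'M[R]_(p + (n - p), p) := tangentB (elem_mx 0 1) in
     let Ymin : 'M[R]_(p + (n - p), p) := tangentB (elem_mx 0 0) in
     [/\ curv_attained p (n - p) (1 : R) /\
           curv_attained p (n - p) (- 2^-1 : R),
         orthonormal_tangent Xmax Ymax /\ sec_curv Xmax Ymax = 1,
         forall X Y : 'M[R]_(p + (n - p), p), orthonormal_tangent X Y ->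
           (sec_curv X Y = 1 <->
            [/\ usubmx X = 0, usubmx Y = 0 &
                trace_preserving_equiv (dsubmx X) (dsubmx Y)
                                       (dsubmx Xmax) (dsubmx Ymax)]),
         orthonormal_tangent Xmin Ymin /\ sec_curv Xmin Ymin = - 2^-1 &
         forall X Y : 'M[R]_(p + (n - p), p), orthonormal_tangent X Y ->
           (sec_curv X Y = - 2^-1 <->
            [/\ usubmx X = 0, usubmx Y = 0 &
                trace_preserving_equiv (dsubmx X) (dsubmx Y)
                                       (dsubmx Xmin) (dsubmx Ymin)])])
  /\
  (* item 2 *)
  (p = 1%N -> (3 <= n)%N ->
     forall X Y : 'M[R]_(p + (n - p), p), orthonormal_tangent X Y ->
       sec_curv X Y = 1)
  /\
  (* item 3 *)
  (p = n -> (4 <= n)%N ->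
     forall X Y : 'M[R]_(p + (n - p), p), orthonormal_tangent X Y ->
       0 <= sec_curv X Y <= 4^-1)
  /\
  (* item 4 *)
  (p = n -> n = 3%N ->
     forall X Y : 'M[R]_(p + (n - p), p), orthonormal_tangent X Y ->
       sec_curv X Y = 8^-1)
  /\
  (* item 5 *)
  (n = 3%N -> p = 2%N ->
     let Xmin : 'M[R]_(p + (n - p), p) := tangentB (elem_mx 0 1) in
     let Ymin : 'M[R]_(p + (n - p), p) := tangentB (elem_mx 0 0) in
     let Xmax : 'M[R]_(p + (n - p), p) := - elem_mx 2 0 in
     let Ymax : 'M[R]_(p + (n - p), p) :=
       (Num.sqrt 2)^-1 *: (elem_mx 1 0 - elem_mx 0 1) in
     [/\ forall X Y : 'M[R]_(p + (n - p), p), orthonormal_tangent X Y ->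
           - 2^-1 <= sec_curv X Y <= 2^-1,
         curv_attained p (n - p) (- 2^-1 : R) /\
           curv_attained p (n - p) (2^-1 : R),
         orthonormal_tangent Xmin Ymin /\ sec_curv Xmin Ymin = - 2^-1 &
         orthonormal_tangent Xmax Ymax /\ sec_curv Xmax Ymax = 2^-1])
  /\
  (* item 6 *)
  ((4 <= n)%N -> p = n.-1 ->
     let Xmin : 'M[R]_(p + (n - p), p) := tangentB (elem_mx 0 1) in
     let Ymin : 'M[R]_(p + (n - p), p) := tangentB (elem_mx 0 0) in
     [/\ forall X Y : 'M[R]_(p + (n - p), p), orthonormal_tangent X Y ->
           - 2^-1 <= sec_curv X Y <= 2 / 3,
         curv_attained p (n - p) (- 2^-1 : R) &
         orthonormal_tangent Xmin Ymin /\ sec_curv Xmin Ymin = - 2^-1]).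
Proof.
split; first by move=> X Y; exact: sec_curv_bounds.
split.
  move=> p2; rewrite -leq_subRL // => q2 /=.
  have q0 : (0 < n - p)%N := ltnW q2.
  have hmax := orthonormal_tangentB_elem_row R q2 p_ge1.
  have hmin := orthonormal_tangentB_elem_col R q0 p2.
  split=> //.
  - by split; [exists (tangentB (elem_mx 1 0)) | exists (tangentB (elem_mx 0 1))];
      exists (tangentB (elem_mx 0 0)).
  - by move=> X Y oXY; rewrite !col_mxKd; exact: sec_curv_eq1.
  - by move=> X Y oXY; rewrite !col_mxKd; exact: sec_curv_eqN2V.
split; first by move=> p1 _; subst p; exact: sec_curv_sphere.
split.
  by move=> pn _ X Y; apply: sec_curv_SO; rewrite pn subnn.
split.
  by move=> pn n3; subst n p => X Y; exact: sec_curv_SO3.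
split.
  move=> n3 p2; subst n p => /=.
  have hmin := orthonormal_tangentB_elem_col R (isT : (0 < 1)%N) (isT : (1 < 2)%N).
  have hmax := sec_curv32_max R.
  split=> //.
  - move=> X Y oXY; have /andP[-> _] := sec_curv_bounds oXY.
    exact: sec_curv32_le.
  - split; first by exists (tangentB (elem_mx 0 1)), (tangentB (elem_mx 0 0)).
    by exists (- elem_mx 2 0), ((Num.sqrt 2)^-1 *: (elem_mx 1 0 - elem_mx 0 1)).
move=> n4 pn /=.
have q1 : (n - p = 1)%N by rewrite pn; case: (n) n4 => // k _; rewrite subSnn.
have q0 : (0 < n - p)%N by rewrite q1.
have p2 : (1 < p)%N by rewrite pn; case: (n) n4 => [|[|[|k]]].
have hmin := orthonormal_tangentB_elem_col R q0 p2.
split=> //.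
- move=> X Y oXY; have /andP[-> _] := sec_curv_bounds oXY.
  exact: sec_curv_row_le23.
- by exists (tangentB (elem_mx 0 1)), (tangentB (elem_mx 0 0)).
Qed.
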